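(* Let $\mathcal I$ be an index set, and for each $i\in\mathcal I$ let $n_i,m_i$ be positive integers. Let $\mathcal A=\{A_{ij}\}_{i,j\in\mathcal I}$ and $\mathcal B=\{B_{ij}\}_{i,j\in\mathcal I}$ be families of complex matrices, where $A_{ij}$ is $n_i\times n_j$ and $B_{ij}$ is $m_i\times m_j$. Assume $\mathcal A$ and $\mathcal B$ are normal in the coupled sense. Suppose $S_i$ is a complex $n_i\times m_i$ matrix for each $i\in\mathcal I$ and $A_{ij}S_j=S_iB_{ij}$ for all $i,j\in\mathcal I$. 1. If $\mathcal A$ and $\mathcal B$ are both irreducible in the coupled sense, then either $S_i=0$ for all $i$, or there is a scalar $\alpha$ such that every $S_i$ is $\alpha$ times a unitary matrix, i.e., $S_i=\alpha U_i$ with $U_i$ unitary. In the latter case, $m_i=n_i$ for all $i$. Furthermore, if $\mathcal A=\mathcal B$, then there is a scalar $\beta$ such that $S_i=\beta I_{n_i}$ for all $i$. 2. If neither $\mathcal A$ nor $\mathcal B$ is properly reducible in the coupled sense, then, for each $i$, either $S_i=0$ or $S_i$ is a scalar multiple of a unitary matrix. In the latter case, $m_i=n_i$. Furthermore, if $\mathcal A=\mathcal B$, then every $S_i$ is a scalar matrix. 3. Suppose neither $\mathcal A$ nor $\mathcal B$ is strongly reducible in the coupled sense. Assume also that $n_i=n$ and $m_i=m$ for all $i\in\mathcal I$, and that the linked graph $\mathcal G(\mathcal A,\mathcal B)$ is connected. Then either $S_i=0$ for all $i$, or there is a scalar $\alpha$ such that each $S_i$ is $\alpha$ times a unitary matrix,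 i.e., $S_i=\alpha U_i$ with $U_i$ unitary. In the latter case $m=n$. Furthermore, if $\mathcal A=\mathcal B$, then there is a scalar $\beta$ such that $S_i=\beta I_n$ for all $i$.
   Context: The index set $\mathcal I$ may be finite or infinite. All matrices are complex and $*$ denotes conjugate transpose. A family $\mathcal A=\{A_{ij}\}_{i,j\in\mathcal I}$, with $A_{ij}$ of size $n_i\times n_j$, is normal in the coupled sense if $A_{ij}^*A_{ij}=A_{ji}A_{ji}^*$ for all $i,j\in\mathcal I$. Let $\mathcal V_i=\mathbb C^{n_i}$. The family $\mathcal A$ is reducible in the coupled sense if there exist subspaces $\mathcal U_i\subseteq\mathcal V_i$ ($i\in\mathcal I$) such that (1) $\mathcal U_i\neq\{0\}$ for at least one $i$; (2) $\mathcal U_i\neq\mathcal V_i$ for at least one $i$; (3) $A_{ij}(\mathcal U_j)\subseteq\mathcal U_i$ for all $i,j\in\mathcal I$. It is irreducible in the coupled sense if it is not reducible in the coupled sense. It is properly reducible (resp. strongly reducible) in the coupled sense if such subspaces exist with, in addition, at least one $\mathcal U_i$ (resp. every $\mathcal U_i$) a nonzero proper subspace of $\mathcal V_i$. The same definitions apply to $\mathcal B$ with $\mathbb C^{m_i}$ in place of $\mathcal V_i$. A matrix has full column rank if its columns are linearly independent. The digraph $\mathcal D(\mathcal A)$ has vertices $\{v_i\}_{i\in\mathcal I}$, with a directed edge from $v_i$ to $v_j$ if and only if $A_{ij}$ has full column rank; $\mathcal D(\mathcal B)$ is defined similarly, on the same vertices, from the $B_{ij}$. Two vertices are strongly connected in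 a digraph if there are directed walks (finite sequences of consecutive directed edges) from each to the other. The linked graph $\mathcal G(\mathcal A,\mathcal B)$ is the undirected graph on vertices $\{v_i\}_{i\in\mathcal I}$ in which $\{v_i,v_j\}$ is an edge if and only if $v_i$ and $v_j$ are strongly connected in $\mathcal D(\mathcal A)$ or strongly connected in $\mathcal D(\mathcal B)$ (or both). It is connected if any two vertices are joined by a finite path of edges. *)

(* Defs.v *)
From Stdlib Require Export Relations.
From mathcomp Require Export all_boot all_order all_algebra.
From mathcomp Require Export complex reals.

Set Implicit Arguments.
Unset Strict Implicit.
Unset Printing Implicit Defensive.

Import GRing.Theory Num.Theory.
Local Open Scope ring_scope.
Local Open Scope complex_scope.
Local Open Scope sesquilinear_scope.

Section Coupled.
Variables (R : realType) (I : Type).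

Definition family (n : I -> nat) : Type := forall i j : I, 'M[R[i]]_(n i, n j).

Definition coupled_normal (n : I -> nat) (A : family n) : Prop :=
  forall i j : I, (A i j)^t* *m A i j = A j i *m (A j i)^t*.

(* Subspaces are spaces of column vectors, on which matrices act from the left. *)
Definition reducing (n : I -> nat) (A : family n)
    (U : forall i : I, {vspace 'cV[R[i]]_(n i)}) : Prop :=
  [/\ exists i, U i <> 0%VS,
      exists i, U i <> fullv
    & forall i j (v : 'cV[R[i]]_(n j)), v \in U j -> A i j *m v \in U i].

Definition nonzero_proper (p : nat) (V : {vspace 'cV[R[i]]_p}) : Prop :=
  V <> 0%VS /\ V <> fullv.

Definition coupled_reducible (n : I -> nat) (A : family n) : Prop :=
  exists U, reducing A U.

Definition coupled_irreducible (n : I -> nat) (A : family n) : Prop :=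
  ~ coupled_reducible A.

Definition coupled_properly_reducible (n : I -> nat) (A : family n) : Prop :=
  exists U, reducing A U /\ exists i, nonzero_proper (U i).

Definition coupled_strongly_reducible (n : I -> nat) (A : family n) : Prop :=
  exists U, reducing A U /\ forall i, nonzero_proper (U i).

Definition full_column_rank (p q : nat) (M : 'M[R[i]]_(p, q)) : bool :=
  row_free M^T.

Definition digraph (n : I -> nat) (A : family n) : relation I :=
  fun i j => full_column_rank (A i j).

(* Walks of length 0 are allowed; this only affects loops of the linked graph,
   which are irrelevant to its connectedness. *)
Definition strongly_connected (e : relation I) (i j : I) : Prop :=
  clos_refl_trans I e i j /\ clos_refl_trans I e j i.

Definition linked_graph (n m : I -> nat) (A : family n) (B : family m) :
    relation I :=
  fun i j => strongly_connected (digraph A) i j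
          \/ strongly_connected (digraph B) i j.

Definition graph_connected (e : relation I) : Prop :=
  forall i j : I, clos_refl_trans I e i j.

(* [unitarymx] only asks for M *m M^t* = 1, hence is used on square matrices
   only: a unitary matrix is square, and [e] is part of the claim. *)
Definition scaled_unitary (p q : nat) (a : R[i]) (M : 'M[R[i]]_(p, q)) : Prop :=
  exists (e : q = p) (U : 'M[R[i]]_p),
    U \is unitarymx /\ castmx (erefl p, e) M = a *: U.

(* Equality of the families A and B, whose types only agree up to [e]. *)
Definition same_family (n m : I -> nat) (e : forall i, m i = n i)
    (A : family n) (B : family m) : Prop :=
  forall i j : I, A i j = castmx (e i, e j) (B i j).

End Coupled.

(* Main.v *)
Require Import Defs.
From mathcomp Require Import boolp.

(** Why the theorem holds.  Fuglede's theorem survives in the coupled setting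
    ([fuglede_putnam_pair], [adj_intertwines]): for normal families the
    relations [A i j *m S j = S i *m B i j] imply
    [B i j *m (S j)^t* = (S i)^t* *m A i j].  Composing the two, the Hermitian
    matrices [S i *m (S i)^t*] commute with the family [A], and the matrices
    [(S i)^t* *m S i] commute with [B].

    If matrices [T i] commute with a family, then for each scalar [l] their
    [l]-eigenspaces form a family of subspaces that is mapped into itself, so
    irreducibility constrains them as in Schur's lemma: once one of them is
    nonzero, all those under consideration are full, that is [T k = l%:M]
    ([all_or_nothing]).  Under irreducibility this reaches every index; under
    absence of proper reducibility it reaches the index itself.  When only
    strong reducibility is excluded, one needs to know that the eigenspaces are
    nonzero, or proper, at all indices simultaneously, which holds because their
    dimension is constant: a full column rank [A i j] embeds the eigenspace at
    [j] into the one at [i], so dimensions agree on strongly connected vertices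
    of either digraph, and for [l != 0] the two Gram matrices of [S i] have
    [l]-eigenspaces of the same dimension, which lets one pass from the digraph
    of [A] to that of [B] ([linked_dim_eigvs]).

    A nonzero [S i] yields a nonzero eigenvalue [l] of [S i *m (S i)^t*], shared
    by [(S i)^t* *m S i]; hence both Gram matrices equal [l%:M] at each relevant
    index, which makes [S k] square and [sqrtC l] times a unitary matrix
    ([all_or_nothing_scaled_unitary]).  When the two families coincide, the
    [S i] themselves commute with [A], and the same dichotomy applied to an
    eigenvalue of some [S i] makes them scalar ([all_or_nothing_scalar]). *)

Set Implicit Arguments.
Unset Strict Implicit.
Unset Printing Implicit Defensive.

Import Order.TTheory GRing.Theory Num.Theory.
Local Open Scope ring_scope.
Local Open Scope complex_scope.
Local Open Scope sesquilinear_scope.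

(** * Adjoints and Fuglede's theorem for pairs of matrices *)

Section Adjoint.
Variable C : numClosedFieldType.

Lemma adjmxM p q r (X : 'M[C]_(p, q)) (Y : 'M[C]_(q, r)) :
  (X *m Y)^t* = Y^t* *m X^t*.
Proof. by rewrite trmx_mul map_mxM. Qed.

Lemma adjmxB p q (X Y : 'M[C]_(p, q)) : (X - Y)^t* = X^t* - Y^t*.
Proof. by rewrite linearB /= map_mxB. Qed.

Lemma mulmx_adj_diag p q (X : 'M[C]_(p, q)) i :
  (X *m X^t*) i i = \sum_j X i j * (X i j)^*.
Proof. by rewrite mxE; apply: eq_bigr => j _; rewrite !mxE. Qed.

Lemma mulmx_adj_diag_ge0 p q (X : 'M[C]_(p, q)) i : 0 <= (X *m X^t*) i i.
Proof.
by rewrite mulmx_adj_diag; apply: sumr_ge0 => j _; apply: mul_conjC_ge0.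
Qed.

Lemma mxtrace_adj_ge0 p q (X : 'M[C]_(p, q)) : 0 <= \tr (X *m X^t*).
Proof. by apply: sumr_ge0 => i _; apply: mulmx_adj_diag_ge0. Qed.

Lemma mxtrace_adj_eq0 p q (X : 'M[C]_(p, q)) : \tr (X *m X^t*) = 0 -> X = 0.
Proof.
move=> trX0; apply/matrixP => i j; rewrite [RHS]mxE; apply/eqP.
rewrite -mul_conjC_eq0; apply/eqP.
have ge0 k : 0 <= X i k * (X i k)^* by apply: mul_conjC_ge0.
apply: (psumr_eq0P (P := predT) (F := fun k => X i k * (X i k)^*)) => //.
rewrite -mulmx_adj_diag.
apply: (psumr_eq0P (P := predT) (F := fun k => (X *m X^t*) k k)) => // k _.
exact: mulmx_adj_diag_ge0.
Qed.

Lemma mulmx_adj_eq0 p q (X : 'M[C]_(p, q)) : X *m X^t* = 0 -> X = 0.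
Proof. by move=> XX0; apply: mxtrace_adj_eq0; rewrite XX0 mxtrace0. Qed.

(** The squared Frobenius norm of the defect [X^t* *m S - T *m X'^t*] is
    expanded and, by normality and the two intertwining relations, expressed
    through the norms of [T *m Y'] and [S *m X'] only.  This expression is
    antisymmetric under the exchange of the roles of [X] and [Y]. *)
Lemma fuglede_trace p q r s (X : 'M[C]_(p, q)) (Y : 'M[C]_(q, p))
    (X' : 'M[C]_(r, s)) (Y' : 'M[C]_(s, r))
    (S : 'M[C]_(p, r)) (T : 'M[C]_(q, s)) :
    X *m X^t* = Y^t* *m Y -> X'^t* *m X' = Y' *m Y'^t* ->
    X *m T = S *m X' -> Y *m S = T *m Y' ->
  \tr ((X^t* *m S - T *m X'^t*) *m (X^t* *m S - T *m X'^t*)^t*)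
    = (\tr (T *m Y' *m (T *m Y')^t*) - \tr (S *m X' *m (S *m X')^t*)) *+ 2.
Proof.
move=> nX nX' XT YS.
set t := \tr (T *m Y' *m _); set s' := \tr (S *m X' *m _).
rewrite adjmxB !adjmxM !trmxCK mulmxBl !mulmxBr !linearB /=.
have -> : \tr (X^t* *m S *m (S^t* *m X)) = t.
  rewrite mxtrace_mulC -mulmxA [X *m _]mulmxA nX /t -YS adjmxM.
  by rewrite [RHS]mxtrace_mulC !mulmxA.
have -> : \tr (T *m X'^t* *m (X' *m T^t*)) = t.
  by rewrite -mulmxA [X'^t* *m _]mulmxA nX' /t adjmxM !mulmxA.
have -> : \tr (T *m X'^t* *m (S^t* *m X)) = s'.
  rewrite mxtrace_mulC -mulmxA [X *m _]mulmxA XT mxtrace_mulC.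
  by rewrite /s' adjmxM !mulmxA.
have -> : \tr (X^t* *m S *m (X' *m T^t*)) = s'.
  by rewrite -mulmxA mxtrace_mulC !mulmxA -(mulmxA (S *m X')) -adjmxM XT.
by rewrite mulr2n opprB.
Qed.

(** This is the Fuglede-Putnam theorem for the normal block matrices
    [[0, X], [Y, 0]] and [[0, X'], [Y', 0]] intertwined by [diag(S, T)].  By
    [fuglede_trace] the squared norms of the two off-diagonal defects are
    opposite to each other; both being nonnegative, they vanish. *)
Lemma fuglede_putnam_pair p q r s (X : 'M[C]_(p, q)) (Y : 'M[C]_(q, p))
    (X' : 'M[C]_(r, s)) (Y' : 'M[C]_(s, r))
    (S : 'M[C]_(p, r)) (T : 'M[C]_(q, s)) :
    X *m X^t* = Y^t* *m Y -> X^t* *m X = Y *m Y^t* ->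
    X' *m X'^t* = Y'^t* *m Y' -> X'^t* *m X' = Y' *m Y'^t* ->
    X *m T = S *m X' -> Y *m S = T *m Y' ->
  X^t* *m S = T *m X'^t*.
Proof.
move=> nX nY nX' nY' XT YS; apply/eqP; rewrite -subr_eq0; apply/eqP.
apply: mxtrace_adj_eq0; apply: le_anti; rewrite mxtrace_adj_ge0 andbT.
have := mxtrace_adj_ge0 (Y^t* *m T - S *m Y'^t*).
rewrite (fuglede_trace nX nY' XT YS).
rewrite (fuglede_trace (esym nY) (esym nX') YS XT).
by rewrite !pmulrn_lge0 ?pmulrn_lle0 // subr_ge0 subr_le0.
Qed.

End Adjoint.

(** * Eigenspaces of column vectors *)

Section Eigenspace.
Variable C : numClosedFieldType.

Definition eigvs p (T : 'M[C]_p) (l : C) : {vspace 'cV[C]_p} :=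
  lker (linfun (mulmx (T - l%:M))).

Lemma mem_eigvs p (T : 'M[C]_p) l (v : 'cV_p) :
  (v \in eigvs T l) = (T *m v == l *: v).
Proof. by rewrite memv_ker lfunE /= mulmxBl mul_scalar_mx subr_eq0. Qed.

Lemma eigvs_full p (T : 'M[C]_p) l : eigvs T l = fullv -> T = l%:M.
Proof.
move=> full; apply/matrixP => i j.
have : delta_mx j 0 \in eigvs T l by rewrite full memvf.
rewrite mem_eigvs => /eqP/matrixP/(_ i 0); rewrite -colE !mxE => ->.
by rewrite eqxx andbT mulr_natr.
Qed.

Lemma eigvs_neq0 p (T : 'M[C]_p) l (v : 'cV_p) :
  v != 0 -> T *m v = l *: v -> eigvs T l <> 0%VS.
Proof.
move=> vN0 Tv E0; have : v \in eigvs T l by rewrite mem_eigvs Tv.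
by rewrite E0 memv0 (negPf vN0).
Qed.

Lemma exists_eigvs p (T : 'M[C]_p) : (0 < p)%N -> exists l, eigvs T l <> 0%VS.
Proof.
move=> p0; have [l /eigenvalueP[v vT vN0]] := eigenvalue_closed T^T p0.
exists l; apply: (@eigvs_neq0 _ _ _ v^T).
  by rewrite -trmx0 (inj_eq trmx_inj).
by rewrite -[T]trmxK -trmx_mul vT linearZ.
Qed.

(** The spectral theorem diagonalises [S *m S^t*]; if its diagonal form were
    zero, then so would be [S]. *)
Lemma exists_eigvs_gram p q (S : 'M[C]_(p, q)) :
  S != 0 -> exists2 l, l != 0 & eigvs (S *m S^t*) l <> 0%VS.
Proof.
move=> SN0; set H := S *m S^t*.
have /orthomx_spectralP : H \is normalmx.
  by apply/normalmxP; rewrite /H adjmxM trmxCK.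
set P := spectralmx H; set d := spectral_diag H => HE.
have uP : P \in unitmx := spectral_unit H.
have [k dk] : exists k, d 0 k != 0.
  apply/existsP; apply: contraNT SN0; rewrite negb_exists => /forallP d0.
  apply/eqP/mulmx_adj_eq0; rewrite -/H HE.
  have -> : d = 0.
    by apply/rowP => k; rewrite mxE; apply/eqP; rewrite -[_ == _]negbK.
  by rewrite raddf0 mulmx0 mul0mx.
(* The columns of [invmx P] are eigenvectors of [H]. *)
exists (d 0 k) => //.
apply: (@eigvs_neq0 _ _ _ (invmx P *m delta_mx k 0)).
  apply/eqP => /(congr1 (mulmx P)); rewrite mulKVmx // mulmx0.
  by move/matrixP/(_ k 0)/eqP; rewrite !mxE !eqxx oner_eq0.
rewrite HE -!mulmxA mulKVmx // scalemxAr; congr (_ *m _).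
apply/matrixP => i j; rewrite !ord1 mul_diag_mx !mxE eqxx andbT.
by case: eqP => [->|_] //=; rewrite !mulr0.
Qed.

(** [Y] maps the eigenspace of [X *m Y] into that of [Y *m X], injectively
    because a vector killed by [Y] is an eigenvector of [X *m Y] for [0] only. *)
Lemma dim_eigvs_mulmx_le p q (X : 'M[C]_(p, q)) (Y : 'M[C]_(q, p)) l :
  l != 0 -> (\dim (eigvs (X *m Y) l) <= \dim (eigvs (Y *m X) l))%N.
Proof.
move=> lN0; rewrite -(@limg_dim_eq _ _ _ (linfun (mulmx Y))).
  apply/dimvS/subvP => _ /memv_imgP[v + ->]; rewrite lfunE /= !mem_eigvs.
  by rewrite -!mulmxA => /eqP ->; rewrite -scalemxAr.
apply/eqP; rewrite -subv0; apply/subvP => v.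
rewrite memv_cap mem_eigvs memv_ker lfunE /= memv0 => /andP[/eqP XYv /eqP Yv0].
move: XYv; rewrite -mulmxA Yv0 mulmx0 => /esym/eqP.
by rewrite scaler_eq0 (negPf lN0).
Qed.

Lemma dim_eigvs_mulmx p q (X : 'M[C]_(p, q)) (Y : 'M[C]_(q, p)) l :
  l != 0 -> \dim (eigvs (X *m Y) l) = \dim (eigvs (Y *m X) l).
Proof. by move=> lN0; apply/eqP; rewrite eqn_leq !dim_eigvs_mulmx_le. Qed.

End Eigenspace.

(** * Matrices whose Gram matrices are scalar *)

Section ScaledUnitary.
Variable R : realType.

Lemma gram_scalar_ge0 p q (M : 'M[R[i]]_(p, q)) l :
  (0 < p)%N -> M *m M^t* = l%:M -> 0 <= l.
Proof.
case: p M => // p M _ MM; have := mulmx_adj_diag_ge0 M 0.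
by rewrite MM mxE eqxx.
Qed.

Lemma gram_scalar_square p q (M : 'M[R[i]]_(p, q)) l : l != 0 ->
  M *m M^t* = l%:M -> M^t* *m M = l%:M -> q = p.
Proof.
move=> lN0 MM MM'; have bound r s (X : 'M[R[i]]_(r, s)) Y :
    X *m Y = l%:M -> (r <= s)%N.
  move=> XY; apply: (@mulmx1_min _ _ _ (l^-1 *: X) Y).
  by rewrite -scalemxAl XY scale_scalar_mx mulVf.
by apply/eqP; rewrite eqn_leq (bound _ _ _ _ MM) (bound _ _ _ _ MM').
Qed.

Lemma gram_scalar_unitary p q (M : 'M[R[i]]_(p, q)) (l : R[i]) :
    0 <= l -> l != 0 -> M *m M^t* = l%:M -> q = p ->
  scaled_unitary (sqrtC l) M.
Proof.
move=> l_ge0 lN0 MM qp; subst q.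
have sN0 : sqrtC l != 0 by rewrite sqrtC_eq0.
have sreal : Num.conj (sqrtC l) = sqrtC l.
  by apply/CrealP; apply: ger0_real; rewrite sqrtC_ge0.
exists erefl, ((sqrtC l)^-1 *: M); split; last first.
  by rewrite castmx_id scalerA mulfV // scale1r.
apply/unitarymxP; rewrite linearZ /= map_mxZ -scalemxAl -scalemxAr MM.
rewrite fmorphV /= sreal !scale_scalar_mx; congr (_%:M).
by rewrite mulrA -expr2 exprVn sqrtCK mulVf.
Qed.

End ScaledUnitary.

(** * Coupled families *)

Section Families.
Variables (R : realType) (I : Type).
Implicit Types n m : I -> nat.

(** Each pair of indices reduces to [fuglede_putnam_pair] applied to [A i j] and
    [A j i], whose hypotheses are coupled normality at [(i, j)] and [(j, i)]. *)
Lemma adj_intertwines n m (A : family R n) (B : family R m)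
    (S : forall i, 'M[R[i]]_(n i, m i)) :
    coupled_normal A -> coupled_normal B ->
    (forall i j, A i j *m S j = S i *m B i j) ->
  forall i j, B i j *m (S j)^t* = (S i)^t* *m A i j.
Proof.
move=> nA nB AS i j; rewrite -[LHS]trmxCK adjmxM trmxCK.
have <- := fuglede_putnam_pair (esym (nA j i)) (nA i j) (esym (nB j i)) (nB i j)
             (AS i j) (AS j i).
by rewrite adjmxM trmxCK.
Qed.

Definition commutes n (A : family R n) (T : forall i, 'M[R[i]]_(n i)) : Prop :=
  forall i j, A i j *m T j = T i *m A i j.

Lemma mulmx_commutes n m (A : family R n) (B : family R m)
    (S : forall i, 'M[R[i]]_(n i, m i)) (T : forall i, 'M[R[i]]_(m i, n i)) :
    (forall i j, A i j *m S j = S i *m B i j) ->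
    (forall i j, B i j *m T j = T i *m A i j) ->
  commutes A (fun i => S i *m T i).
Proof. by move=> AS BT i j; rewrite mulmxA AS -!mulmxA BT. Qed.

Lemma eigvs_invariant n (A : family R n) T l : commutes A T ->
  forall i j (v : 'cV_(n j)), v \in eigvs (T j) l ->
    A i j *m v \in eigvs (T i) l.
Proof.
move=> AT i j v; rewrite !mem_eigvs mulmxA -AT -mulmxA => /eqP ->.
by rewrite scalemxAr.
Qed.

(** The common form in which the three irreducibility assumptions are used.  The
    set [J] is the set of indices that one nonzero eigenspace controls: all of
    them in the first and third cases, a single one in the second. *)
Definition all_or_nothing n (J : I -> Prop) (T : forall i, 'M[R[i]]_(n i)) l :=
  forall i, J i -> eigvs (T i) l <> 0%VS -> forall k, J k -> T k = l%:M.

Lemma all_or_nothing_scalar n (J : I -> Prop) (T : forall i, 'M[R[i]]_(n i)) :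
    (forall i, (0 < n i)%N) -> (forall l, all_or_nothing J T l) ->
  exists b, forall k, J k -> T k = b%:M.
Proof.
move=> n_gt0 aonT; have [[i Ji]|noJ] := EM (exists i, J i).
  by have [b bE] := exists_eigvs (T i) (n_gt0 i); exists b; apply: aonT bE.
by exists 0 => k Jk; case: noJ; exists k.
Qed.

(** Only nonzero eigenvalues are considered in the hypotheses: this suffices
    since [S i != 0], and it is for these that the eigenspaces of the two Gram
    matrices have equal dimensions. *)
Lemma all_or_nothing_scaled_unitary n m (J : I -> Prop)
    (S : forall i, 'M[R[i]]_(n i, m i)) i :
    (forall k, (0 < n k)%N) ->
    (forall l, l != 0 -> all_or_nothing J (fun k => S k *m (S k)^t*) l) ->
    (forall l, l != 0 -> all_or_nothing J (fun k => (S k)^t* *m S k) l) ->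
    J i -> S i != 0 ->
  exists a, forall k, J k -> scaled_unitary a (S k) /\ m k = n k.
Proof.
move=> n_gt0 aonP aonQ Ji SiN0; have [l lN0 lE] := exists_eigvs_gram SiN0.
have P k (Jk : J k) : S k *m (S k)^t* = l%:M := aonP l lN0 i Ji lE k Jk.
have lE' : eigvs ((S i)^t* *m S i) l <> 0%VS.
  move=> /eqP; rewrite -dimv_eq0 -dim_eigvs_mulmx // dimv_eq0.
  exact/negP/eqP.
have Q k (Jk : J k) : (S k)^t* *m S k = l%:M := aonQ l lN0 i Ji lE' k Jk.
exists (sqrtC l) => k Jk; have mn := gram_scalar_square lN0 (P k Jk) (Q k Jk).
by split=> //; apply: gram_scalar_unitary (P k Jk) mn => //;
  apply: gram_scalar_ge0 (P k Jk).
Qed.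

Lemma irreducible_all_or_nothing n (A : family R n) T l :
    coupled_irreducible A -> commutes A T ->
  all_or_nothing (fun=> True) T l.
Proof.
move=> irrA AT i _ Ui k _; apply/eigvs_full/eqP/contraT => /eqP Uk.
case: irrA; exists (fun i => eigvs (T i) l).
by split; [exists i|exists k|apply: eigvs_invariant].
Qed.

Lemma not_properly_reducible_all_or_nothing n (A : family R n) T l i :
    ~ coupled_properly_reducible A -> commutes A T ->
  all_or_nothing (eq i) T l.
Proof.
move=> nprA AT _ <- Ui _ <-; apply/eigvs_full/eqP/contraT => /eqP Uk.
case: nprA; exists (fun i => eigvs (T i) l); split; last by exists i.
by split; [exists i|exists i|apply: eigvs_invariant].
Qed.

(** As the ambient spaces all have dimension [p], eigenspaces of constant
    dimension are all zero, all full, or all proper and nonzero; the last case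
    is what strong reducibility means. *)
Lemma not_strongly_reducible_all_or_nothing n (A : family R n) T l (p : nat) :
    ~ coupled_strongly_reducible A -> (forall i, n i = p) -> commutes A T ->
    (forall i j, \dim (eigvs (T i) l) = \dim (eigvs (T j) l)) ->
  all_or_nothing (fun=> True) T l.
Proof.
move=> nsrA nE AT dimE i _ Ui k _; apply/eigvs_full/eqP/contraT => /eqP Uk.
case: nsrA; exists (fun i => eigvs (T i) l).
have UN0 j : eigvs (T j) l <> 0%VS.
  move/eqP; rewrite -dimv_eq0 (dimE j i) dimv_eq0; exact/negP/eqP.
have UNf j : eigvs (T j) l <> fullv.
  move=> Uj; apply: Uk; apply/eqP; rewrite eqEdim subvf (dimE k j) Uj.
  by rewrite !dimvf /dim /= !nE.
by split=> //; split; [exists i|exists k|apply: eigvs_invariant].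
Qed.

Lemma full_column_rank_inj p q r (M : 'M[R[i]]_(p, q)) (X : 'M_(q, r)) :
  full_column_rank M -> M *m X = 0 -> X = 0.
Proof.
move=> fM MX; apply: trmx_inj; apply: (row_free_inj fM).
by rewrite /= -trmx_mul MX !trmx0 mul0mx.
Qed.

(** Along an edge of the digraph, [A i j] is injective and maps the eigenspace at
    [j] into the one at [i]: dimensions decrease along walks. *)
Lemma walk_dim_eigvs_le n (A : family R n) T l i j : commutes A T ->
  clos_refl_trans I (digraph A) i j ->
  (\dim (eigvs (T j) l) <= \dim (eigvs (T i) l))%N.
Proof.
move=> AT; elim=> {i j} [i j Aij|//|i k j _ ki _ jk]; last exact: leq_trans ki.
rewrite -(@limg_dim_eq _ _ _ (linfun (mulmx (A i j)))).
  apply/dimvS/subvP => _ /memv_imgP[v Uv ->]; rewrite lfunE /=.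
  exact: eigvs_invariant Uv.
apply/eqP; rewrite -subv0; apply/subvP => v.
rewrite memv_cap memv0 => /andP[_]; rewrite memv_ker lfunE /= => /eqP Av0.
exact/eqP/(full_column_rank_inj Aij).
Qed.

Lemma strongly_connected_dim_eigvs n (A : family R n) T l i j : commutes A T ->
  strongly_connected (digraph A) i j ->
  \dim (eigvs (T i) l) = \dim (eigvs (T j) l).
Proof.
move=> AT [ij ji]; apply/eqP; rewrite eqn_leq.
by rewrite (walk_dim_eigvs_le l AT ij) (walk_dim_eigvs_le l AT ji).
Qed.

(** The equality of dimensions of the two kinds of eigenspaces at each vertex is
    what allows a path to alternate between strong connections in the two
    digraphs. *)
Lemma linked_dim_eigvs n m (A : family R n) (B : family R m) T T' l i j :
    commutes A T -> commutes B T' ->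
    (forall k, \dim (eigvs (T k) l) = \dim (eigvs (T' k) l)) ->
  clos_refl_trans I (linked_graph A B) i j ->
  \dim (eigvs (T i) l) = \dim (eigvs (T j) l).
Proof.
move=> AT BT' dTT'; elim=> {i j} [i j [|]|//|i k j _ -> _ -> //].
  exact: strongly_connected_dim_eigvs.
rewrite !dTT'; exact: strongly_connected_dim_eigvs.
Qed.

(** Once the size equalities [e] are eliminated, the intertwining relation is
    literally commutation with [A]. *)
Lemma same_family_commutes n m (A : family R n) (B : family R m)
    (S : forall i, 'M[R[i]]_(n i, m i)) (e : forall i, m i = n i) :
    same_family e A B -> (forall i j, A i j *m S j = S i *m B i j) ->
  commutes A (fun i => castmx (erefl (n i), e i) (S i)).
Proof.
move=> AB AS i j; move: (A i j) (B i j) (AB i j) (AS i j) => Aij Bij -> {AB AS}.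
move: (S i) (S j) (e i) (e j) => Si Sj ei ej.
by case: _ / ei in Si *; case: _ / ej in Sj *; rewrite !castmx_id.
Qed.

Lemma linked_graph_same_family n m (A : family R n) (B : family R m)
    (e : forall i, m i = n i) i j :
  same_family e A B -> linked_graph A B i j ->
  strongly_connected (digraph A) i j.
Proof.
move=> AB [//|]; suff BA k h : digraph B k h -> digraph A k h.
  case=> ij ji; split.
    by elim: ij => *; [apply/rt_step/BA|apply: rt_refl|apply: rt_trans; eauto].
  by elim: ji => *; [apply/rt_step/BA|apply: rt_refl|apply: rt_trans; eauto].
rewrite /digraph AB /full_column_rank trmx_cast /=.
move: (B k h)^T => M; move: (e k) (e h) => ek eh.
by case: _ / ek; case: _ / eh in M *; rewrite castmx_id.
Qed.

End Families.

(** * The three cases *)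

Theorem theorem6p2 (R : realType) (I : Type) (n m : I -> nat)
  (n_gt0 : forall i, (0 < n i)%N) (m_gt0 : forall i, (0 < m i)%N)
  (A : family R n) (B : family R m)
  (normA : coupled_normal A) (normB : coupled_normal B)
  (S : forall i, 'M[R[i]]_(n i, m i))
  (ABS : forall i j, A i j *m S j = S i *m B i j) :
  [/\ (coupled_irreducible A -> coupled_irreducible B ->
        ((forall i, S i = 0) \/
         ((exists alpha : R[i], forall i, scaled_unitary alpha (S i)) /\
          forall i, m i = n i)) /\
        (forall e : forall i, m i = n i, same_family e A B ->
          exists beta : R[i],
            forall i, castmx (erefl (n i), e i) (S i) = beta%:M)),
      (~ coupled_properly_reducible A -> ~ coupled_properly_reducible B ->
        (forall i, S i = 0 \/
          ((exists alpha : R[i], scaled_unitary alpha (S i)) /\ m i = n i)) /\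
        (forall e : forall i, m i = n i, same_family e A B ->
          forall i, exists beta : R[i],
            castmx (erefl (n i), e i) (S i) = beta%:M))
    & (forall n0 m0 : nat,
        ~ coupled_strongly_reducible A -> ~ coupled_strongly_reducible B ->
        (forall i, n i = n0) -> (forall i, m i = m0) ->
        graph_connected (linked_graph A B) ->
        ((forall i, S i = 0) \/
         ((exists alpha : R[i], forall i, scaled_unitary alpha (S i)) /\
          m0 = n0)) /\
        (forall e : forall i, m i = n i, same_family e A B ->
          exists beta : R[i],
            forall i, castmx (erefl (n i), e i) (S i) = beta%:M))].
Proof.
have BSA := adj_intertwines normA normB ABS.
pose P i := S i *m (S i)^t*; pose Q i := (S i)^t* *m S i.
have AP : commutes A P := mulmx_commutes ABS BSA.
have BQ : commutes B Q := mulmx_commutes BSA ABS.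
split.
- move=> irrA irrB; split.
    have [S0|/existsNP[i /eqP SiN0]] := EM (forall i, S i = 0); first by left.
    right.
    have [|||a aS] :=
      all_or_nothing_scaled_unitary (J := fun=> True) n_gt0 _ _ _ SiN0.
    + by move=> l _; apply: irreducible_all_or_nothing AP.
    + by move=> l _; apply: irreducible_all_or_nothing BQ.
    + by [].
    by split; [exists a => k|move=> k]; have [] := aS k Logic.I.
  move=> e AB; have AT := same_family_commutes AB ABS.
  set T := (fun i => castmx _ _) in AT.
  have [l|b bE] := all_or_nothing_scalar (J := fun=> True) (T := T) n_gt0.
    exact: irreducible_all_or_nothing irrA AT.
  by exists b => i; apply: bE.
- move=> nprA nprB; split=> [i|e AB i].
    have [->|SiN0] := eqVneq (S i) 0; [by left|right].
    have [|||a aS] :=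
      all_or_nothing_scaled_unitary (J := eq i) n_gt0 _ _ _ SiN0.
    + by move=> l _; apply: not_properly_reducible_all_or_nothing AP.
    + by move=> l _; apply: not_properly_reducible_all_or_nothing BQ.
    + by [].
    by have [aSi mn] := aS i erefl; split=> //; exists a.
  have AT := same_family_commutes AB ABS.
  set T := (fun i => castmx _ _) in AT.
  have [l|b bE] := all_or_nothing_scalar (J := eq i) (T := T) n_gt0.
    exact: not_properly_reducible_all_or_nothing nprA AT.
  by exists b; apply: bE.
- move=> n0 m0 nsrA nsrB nE mE conn; split.
    have [S0|/existsNP[i /eqP SiN0]] := EM (forall i, S i = 0); first by left.
    right.
    have dPQ l k : l != 0 -> \dim (eigvs (P k) l) = \dim (eigvs (Q k) l).
      exact: dim_eigvs_mulmx.
    have dP l k h : l != 0 -> \dim (eigvs (P k) l) = \dim (eigvs (P h) l).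
      move=> lN0; apply: linked_dim_eigvs AP BQ _ (conn k h) => j.
      exact: dPQ.
    have [|||a aS] :=
      all_or_nothing_scaled_unitary (J := fun=> True) n_gt0 _ _ _ SiN0.
    + move=> l lN0.
      apply: not_strongly_reducible_all_or_nothing nE AP _ => // k h.
      exact: dP.
    + move=> l lN0.
      apply: not_strongly_reducible_all_or_nothing mE BQ _ => // k h.
      by rewrite -!dPQ //; apply: dP.
    + by [].
    split; first by exists a => k; have [] := aS k Logic.I.
    by have [_] := aS i Logic.I; rewrite nE mE.
  move=> e AB; have AT := same_family_commutes AB ABS.
  set T := (fun i => castmx _ _) in AT.
  have [l|b bE] := all_or_nothing_scalar (J := fun=> True) (T := T) n_gt0.
    apply: (not_strongly_reducible_all_or_nothing nsrA nE AT) => i j.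
    elim: (conn i j) => [{}i {}j ij|//|{}i k {}j _ -> _ -> //].
    exact: strongly_connected_dim_eigvs AT (linked_graph_same_family AB ij).
  by exists b => i; apply: bE.
Qed.
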